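(* Let $V$ be a capacity on $(\Omega,\mathcal F)$ and let $X_1,X_2$ be real random variables on $(\Omega,\mathcal F)$ that are exponential independent. Then for all $a,b\in\mathbb R$, $$V(X_1\le a,\ X_2\le b)=V(X_1\le a)\,V(X_2\le b),$$ and for any Borel sets $A,B\subseteq\mathbb R$, $$V(X_1\in A,\ X_2\in B)=V(X_1\in A)\,V(X_2\in B).$$
   Context: $(\Omega,\mathcal F)$ is a measurable space. A capacity is a set function $V:\mathcal F\to[0,1]$ with $V(\emptyset)=0$, $V(\Omega)=1$, and $V(A)\le V(B)$ whenever $A\subseteq B$, $A,B\in\mathcal F$. A random variable is an $\mathcal F$-measurable map $\Omega\to\mathbb R$. The Choquet integral of a bounded random variable $X$ is $$E_V[X]=\int_0^{+\infty}V(\{X\ge t\})\,dt+\int_{-\infty}^0\big[V(\{X\ge t\})-1\big]\,dt.$$ $X_1$ and $X_2$ are exponential independent (i.e. $X_2$ is exponential independent of $X_1$) if for all bounded Borel measurable functions $\varphi_1,\varphi_2:\mathbb R\to\mathbb R$, $$E_V\big[e^{\varphi_1(X_1)+\varphi_2(X_2)}\big]=E_V\big[e^{\varphi_1(X_1)}\big]\cdot E_V\big[e^{\varphi_2(X_2)}\big].$$ *)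

(* Defs.v *)
From HB Require Import structures.
From mathcomp Require Import all_boot all_order all_algebra.
From mathcomp Require Import all_classical all_reals all_analysis.

Set Implicit Arguments.
Unset Strict Implicit.
Unset Printing Implicit Defensive.

Import Order.TTheory GRing.Theory Num.Theory.
Import numFieldNormedType.Exports.

Local Open Scope classical_set_scope.
Local Open Scope ring_scope.

(* A capacity lives on the sigma-algebra only: the values of [V] at
   non-measurable sets are junk and are not constrained. *)
Record is_capacity (R : realType) (d : measure_display)
    (Omega : measurableType d) (V : set Omega -> R) : Prop := IsCapacity {
  capacity_range : forall A, measurable A -> 0 <= V A <= 1 ;
  capacity_set0 : V set0 = 0 ;
  capacity_setT : V setT = 1 ;
  capacity_mono : forall A B, measurable A -> measurable B ->
    A `<=` B -> V A <= V B }.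

(* Meaningful for [V] a capacity and [X] measurable and bounded: both integrands
   are then monotone and have bounded support, so the value is finite. *)
Definition choquet (R : realType) (d : measure_display)
    (Omega : measurableType d) (V : set Omega -> R) (X : Omega -> R) : \bar R :=
  (\int[lebesgue_measure]_(t in `[0%R, +oo[) (V [set w | t <= X w])%:E
   + \int[lebesgue_measure]_(t in `]-oo, 0%R]) (V [set w | t <= X w] - 1)%:E)%E.

Definition exponential_independent (R : realType) (d : measure_display)
    (Omega : measurableType d) (V : set Omega -> R) (X1 X2 : Omega -> R) :=
  forall phi1 phi2 : R -> R,
    measurable_fun setT phi1 -> bounded_fun phi1 ->
    measurable_fun setT phi2 -> bounded_fun phi2 ->
    (choquet V (fun w => expR (phi1 (X1 w) + phi2 (X2 w))) =
     choquet V (fun w => expR (phi1 (X1 w))) *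
     choquet V (fun w => expR (phi2 (X2 w))))%E.

(* Main.v *)
(** Test exponential independence on [phi1 = ln s * \1_A] and
    [phi2 = ln s * \1_B].  All Choquet integrals are then integrals of functions
    with at most three values, and with [x = s - 1] the hypothesis becomes
    [x V(A u B) + x (x + 1) V(A n B) = x V(A) + x V(B) + x^2 V(A) V(B)].
    Here [V(A u B)] is unknown, but it is eliminated by dividing by [x] and
    subtracting two instances (s = 2 and s = 3). *)
Require Import Defs.
From HB Require Import structures.
From mathcomp Require Import all_boot all_order all_algebra.
From mathcomp Require Import all_classical all_reals all_analysis.
From mathcomp Require Import measurable_realfun lra.

Import Order.TTheory GRing.Theory Num.Theory.
Import numFieldNormedType.Exports.

Local Open Scope classical_set_scope.
Local Open Scope ring_scope.

Lemma integral_layer (R : realType) (k p : R) : 0 <= k -> 0 <= p ->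
  (\int[lebesgue_measure]_(t in `[0%R, +oo[) (k * \1_(`]-oo, p]) t)%:E =
   (k * p)%:E)%E.
Proof.
move=> k0 p0; rewrite integralZl_indic//; last by move=> /lt_geF; rewrite k0.
rewrite integral_indic//.
rewrite (_ : `]-oo, p]%classic `&`
    `[0%R, +oo[%classic
    = `[0%R, p]%classic :> set R); last first.
  apply/seteqP; split=> t /=; rewrite !in_itv/= ?andbT; last by case/andP.
  by case=> -> ->.
rewrite /= lebesgue_measure_itv/= lte_fin; case: ltP => p0'.
  by rewrite sube0.
by have /eqP -> : p == 0; rewrite ?eq_le ?p0 ?p0'// mule0 mulr0.
Qed.

(** The level set at [t] is [setT] up to [p], [C] on []p, q]], [D] on []q, r]] and empty beyond [r].
    The weak inequalities admit degenerate cases, such as functions with only two values. *)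
Lemma choquet_three_values (R : realType) (d : measure_display)
    (Omega : measurableType d) (V : set Omega -> R) (hV : is_capacity V)
    (C D : set Omega) (p q r : R) (Y : Omega -> R) :
  measurable C -> measurable D -> D `<=` C -> 0 <= p <= q -> q <= r ->
  (forall w, Y w = if w \in D then r else if w \in C then q else p) ->
  choquet V Y = ((1 - V C) * p + (V C - V D) * q + V D * r)%:E.
Proof.
move=> mC mD DC /andP[p0 pq] qr YE.
have [VD0 VD1] := andP (capacity_range hV mD).
have [VC0 VC1] := andP (capacity_range hV mC).
have VDC : V D <= V C by exact: capacity_mono hV _ _ mD mC DC.
have YT t : t <= p -> [set w | t <= Y w] = setT.
  move=> tp; apply/seteqP; split=> // w _ /=; rewrite YE.
  by case: ifP => _; [|case: ifP => _]; lra.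
(* For [t <= 0 <= p] the level set is [setT], of capacity 1, so the negative half-line contributes
   nothing. *)
rewrite /choquet [X in (_ + X)%E]integral0_eq ?adde0; last first.
  move=> t /=; rewrite in_itv/= => t0.
  by rewrite YT ?(le_trans t0)// (capacity_setT hV) subrr.
have mlayer (k s : R) : measurable_fun (`[0%R, +oo[ : set R)
    (fun t : R => (k * \1_(`]-oo, s]) t)%:E).
  apply/measurable_EFinP; exact: measurable_funM.
have layer0 (k s t : R) : 0 <= k -> (0 <= (k * \1_(`]-oo, s]) t)%:E)%E.
  by move=> k0; rewrite lee_fin mulr_ge0.
(* [1 - V C], [V C - V D] and [V D] are nonnegative by monotonicity, so the level
   function is written as a sum of layers based at [-oo] with these weights. *)
transitivity (\int[lebesgue_measure]_(t in `[0%R, +oo[)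
    (((1 - V C) * \1_(`]-oo, p]) t)%:E
     + (((V C - V D) * \1_(`]-oo, q]) t)%:E
        + (V D * \1_(`]-oo, r]) t)%:E)))%E.
  apply: eq_integral => t _; rewrite -!EFinD; congr (_%:E).
  rewrite !indicE !mem_setE !in_itv/=.
  have [tp|pt] := leP t p.
    rewrite YT// (capacity_setT hV) (le_trans tp pq).
    by rewrite (le_trans tp (le_trans pq qr)) /=; lra.
  have [tq|qt] := leP t q.
    rewrite (le_trans tq qr) (_ : [set w | _] = C) /=; first by lra.
    apply/seteqP; split=> w /=; rewrite YE.
      case: ifP => [/set_mem /DC//|_]; case: ifP => [/set_mem//|_].
      by rewrite leNgt pt.
    by move=> /mem_set ->; case: ifP => _ //; exact: le_trans qr.
  have [tr|rt] := leP t r.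
    rewrite (_ : [set w | _] = D) /=; first by lra.
    apply/seteqP; split=> w /=; rewrite YE.
      by case: ifP => [/set_mem//|_]; case: ifP => _; lra.
    by move=> /mem_set ->.
  rewrite (_ : [set w | _] = set0) /= ?(capacity_set0 hV); first by lra.
  apply/seteqP; split=> w //=; rewrite YE.
  by case: (w \in D); [|case: (w \in C)]; lra.
rewrite !ge0_integralD//=; first last.
- by apply: emeasurable_funD; exact: mlayer.
- by move=> t _; apply: adde_ge0; apply: layer0; lra.
- exact: mlayer.
- by move=> t _; apply: layer0; lra.
- exact: mlayer.
- by move=> t _; apply: layer0; lra.
- exact: mlayer.
- by move=> t _; apply: layer0; lra.
by rewrite !integral_layer -?EFinD ?addrA//; lra.
Qed.

(** The product of the two exponentials is [s ^+ 2] on the intersection, [s] on the rest of the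
    union and 1 elsewhere; [1 <= s] puts these values in increasing order. *)
Lemma capacity_exp_independent_eq (R : realType) (d : measure_display)
    (Omega : measurableType d) (V : set Omega -> R) (hV : is_capacity V)
    (X1 X2 : {mfun Omega >-> R}) (hX : exponential_independent V X1 X2)
    (A B : set R) (s : R) : measurable A -> measurable B -> 1 <= s ->
  let VA := V (X1 @^-1` A) in let VB := V (X2 @^-1` B) in
  let VI := V (X1 @^-1` A `&` X2 @^-1` B) in
  let VU := V (X1 @^-1` A `|` X2 @^-1` B) in
  (1 - VU) + (VU - VI) * s + VI * s ^+ 2 =
  ((1 - VA) + VA * s) * ((1 - VB) + VB * s).
Proof.
move=> mA mB s1 VA VB VI VU.
have s0 : 0 < s by lra.
have ss : s <= s ^+ 2 by rewrite expr2 ler_peMl// ltW.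
have mXA : measurable (X1 @^-1` A).
  by rewrite -[X in measurable X]setTI; exact: measurable_funP.
have mXB : measurable (X2 @^-1` B).
  by rewrite -[X in measurable X]setTI; exact: measurable_funP.
(* A bounded Borel function whose exponential is [s] on [E] and 1 off [E]. *)
pose phi (E : set R) (y : R) : R := ln s * \1_E y.
have expphi E y : expR (phi E y) = if y \in E then s else 1.
  by rewrite /phi indicE; case: ifP => _; rewrite ?mulr1 ?lnK ?posrE// mulr0 expR0.
have mphi E : measurable E -> measurable_fun setT (phi E).
  by move=> mE; apply: measurable_funM.
have bphi E : bounded_fun (phi E).
  exists `|ln s|; split; first exact: num_real.
  move=> M lM y _; apply: le_trans (ltW lM).
  rewrite normrM ler_piMr//= indicE; case: (_ \in _); rewrite ?normr1 ?normr0//.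
have := hX _ _ (mphi _ mA) (bphi A) (mphi _ mB) (bphi B).
have one_value (X : {mfun Omega >-> R}) E : measurable (X @^-1` E) ->
    choquet V (fun w => expR (phi E (X w))) =
    ((1 - V (X @^-1` E)) + V (X @^-1` E) * s)%:E.
  move=> mE.
  (* Two values only: the top set is empty and its value repeats [s]. *)
  rewrite (@choquet_three_values _ _ _ _ hV (X @^-1` E) set0 1 s s)//.
  - by rewrite (capacity_set0 hV); congr (_%:E); lra.
  - by lra.
  - by move=> w; rewrite expphi in_set0 /=.
rewrite !one_value//.
rewrite (@choquet_three_values _ _ _ _ hV (X1 @^-1` A `|` X2 @^-1` B)
  (X1 @^-1` A `&` X2 @^-1` B) 1 s (s ^+ 2))//.
- by rewrite -EFinM mulr1 => -[].
- exact: measurableU.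
- exact: measurableI.
- by move=> w [? _]; left.
- by lra.
move=> w; rewrite expRD !expphi in_setI in_setU.
rewrite (_ : (w \in X1 @^-1` A) = (X1 w \in A)); last by [].
rewrite (_ : (w \in X2 @^-1` B) = (X2 w \in B)); last by [].
by case: (_ \in A); case: (_ \in B) => /=; rewrite ?mulr1 ?mul1r.
Qed.

Theorem proposition3p3 (R : realType) (d : measure_display)
    (Omega : measurableType d) (V : set Omega -> R) (hV : is_capacity V)
    (X1 X2 : {mfun Omega >-> R}) (hX : exponential_independent V X1 X2) :
  (forall a b : R,
     V [set w | X1 w <= a /\ X2 w <= b] =
     V [set w | X1 w <= a] * V [set w | X2 w <= b]) /\
  (forall A B : set R, measurable A -> measurable B ->
     V [set w | A (X1 w) /\ B (X2 w)] =
     V [set w | A (X1 w)] * V [set w | B (X2 w)]).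
Proof.
have borel (A B : set R) : measurable A -> measurable B ->
    V [set w | A (X1 w) /\ B (X2 w)] =
    V [set w | A (X1 w)] * V [set w | B (X2 w)].
  move=> mA mB.
  have E2 := capacity_exp_independent_eq _ _ _ _ hV _ _ hX A B 2 mA mB ltac:(lra).
  have E3 := capacity_exp_independent_eq _ _ _ _ hV _ _ hX A B 3 mA mB ltac:(lra).
  rewrite /= in E2 E3.
  rewrite -/(X1 @^-1` A) -/(X2 @^-1` B) -/(X1 @^-1` A `&` X2 @^-1` B).
  (* Half of [E3] minus [E2] cancels the capacity of the union and leaves exactly the product
     formula. *)
  by move: E2 E3; nra.
(* The first claim is the Borel one for closed half-lines. *)
split=> [a b|//].
by apply: (borel [set x | x <= a] [set x | x <= b]);
  rewrite -set_itvNyc; exact: measurable_itv.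
Qed.
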